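(* Let $R_{k,n}$ be the set of primitive integer generators of the rays of the Dressian $\mathrm{Dr}(k,n)$ modulo its lineality space. For any subcollection $\{\pi_1,\dots,\pi_d\}\subseteq R_{k,n}$ which is maximal by inclusion among subcollections of pairwise compatible elements (i.e. $\pi_i+\pi_j\in\mathrm{Dr}(k,n)$ for all $i,j\in[d]$), the cone $\{t_1\pi_1+\dots+t_d\pi_d: t_1,\dots,t_d\ge0\}$ is a maximal cone of $\mathrm{Dr}(k,n)$. Moreover, every maximal cone of $\mathrm{Dr}(k,n)$ is uniquely characterized by such a collection.
   Context: The Dressian $\mathrm{Dr}(k,n)\subset\mathbb{R}^{\binom{n}{k}}$ is the polyhedral fan of vectors $\pi$ such that for every $L\in\binom{[n]}{k-2}$ and every $\{a,b,c,d\}\in\binom{[n]}{4}$ disjoint from $L$, the minimum of $\pi_{Lab}+\pi_{Lcd},\ \pi_{Lac}+\pi_{Lbd},\ \pi_{Lad}+\pi_{Lbc}$ is attained at least twice ($\pi_{LS}$ denotes the coordinate indexed by $L\cup S$). Its lineality space is the image of the linear map $\mathbb{R}^n\to\mathbb{R}^{\binom{n}{k}}$, $x\mapsto(\sum_{i\in I}x_i)_I$. *)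

(* Defs.v *)
From HB Require Import structures.
From mathcomp Require Import all_boot all_order all_algebra.
From mathcomp Require Import generic_quotient ring_quotient.
From mathcomp Require Import finmap.
From mathcomp Require Import boolp classical_sets reals.

Set Implicit Arguments.
Unset Strict Implicit.
Unset Printing Implicit Defensive.

Import Order.TTheory GRing.Theory Num.Theory.

Local Open Scope classical_set_scope.
Local Open Scope ring_scope.
Local Open Scope quotient_scope.

Section QuotientSpace.
Variables (K : fieldType) (V : vectType K) (U : {vspace V}).

(* The quotient vector space V / U: the library quotient of the additive group
   V by U, equipped below with its scalar multiplication. *)
Definition vquot : Type := Quotient.quot (pred_of_vspace U : zmodClosed V).

HB.instance Definition _ := Choice.on vquot.
HB.instance Definition _ := GRing.Zmodule.on vquot.

Definition vproj (v : V) : vquot :=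
  \pi_(Quotient.quot (pred_of_vspace U : zmodClosed V)) v.

Lemma vproj_eq v w : (vproj v == vproj w) = (v - w \in U).
Proof. by rewrite /vproj -Quotient.idealrBE. Qed.

Lemma vproj_is_zmod_morphism : zmod_morphism vproj.
Proof. by move=> v w; rewrite /vproj raddfB. Qed.

HB.instance Definition _ :=
  GRing.isZmodMorphism.Build V vquot vproj vproj_is_zmod_morphism.

Lemma vproj_surj (x : vquot) : exists v, vproj v = x.
Proof. by exists (repr x); rewrite /vproj reprK. Qed.

Definition vquot_scale (a : K) (x : vquot) : vquot := vproj (a *: repr x).

Lemma vquot_scaleE a v : vquot_scale a (vproj v) = vproj (a *: v).
Proof.
apply/eqP; rewrite /vquot_scale vproj_eq -scalerBr memvZ //.
by rewrite -vproj_eq /vproj reprK.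
Qed.

Fact vquot_scaleA a b x :
  vquot_scale a (vquot_scale b x) = vquot_scale (a * b) x.
Proof. by case: (vproj_surj x) => v <-; rewrite !vquot_scaleE scalerA. Qed.

Fact vquot_scale1 : left_id 1 vquot_scale.
Proof. by move=> x; case: (vproj_surj x) => v <-; rewrite vquot_scaleE scale1r. Qed.

Fact vquot_scaleDr : right_distributive vquot_scale +%R.
Proof.
move=> a x y; case: (vproj_surj x) (vproj_surj y) => v <- [w <-].
by rewrite -raddfD !vquot_scaleE scalerDr raddfD.
Qed.

Fact vquot_scaleDl x : {morph vquot_scale^~ x : a b / a + b}.
Proof.
by move=> a b; case: (vproj_surj x) => v <-; rewrite !vquot_scaleE scalerDl raddfD.
Qed.

HB.instance Definition _ := GRing.Zmodule_isLmodule.Build K vquot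
  vquot_scaleA vquot_scale1 vquot_scaleDr vquot_scaleDl.

Fact vproj_is_scalable : scalable vproj.
Proof. by move=> a v; rewrite -vquot_scaleE. Qed.

HB.instance Definition _ :=
  GRing.isScalable.Build K V vquot *:%R vproj vproj_is_scalable.

End QuotientSpace.

Notation ksubset k n := {I : {set 'I_n} | #|I| == k}.

(* The regular module R^o makes these spaces vector spaces over R. *)
Notation plucker_space R k n := {ffun ksubset k n -> R^o}.
Notation point_space R n := {ffun 'I_n -> R^o}.

Section Dressian.
Variables (R : realType) (k n : nat).
Local Notation V := (plucker_space R k n).
Implicit Types (p q : V) (L A : {set 'I_n}) (a b c d : 'I_n).

(* The value 0 is never used: A always has k elements below. *)
Definition pcoord p A : R := oapp p 0 (insub A).

Definition admissible L a b c d : bool :=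
  [&& #|L|.+2 == k, uniq [:: a; b; c; d]
    & [disjoint L & [set a; b; c; d]%SET]].

Definition pterm p L a b c d (i : 'I_3) : R :=
  nth 0 [:: pcoord p (L :|: [set a; b]) + pcoord p (L :|: [set c; d]);
            pcoord p (L :|: [set a; c]) + pcoord p (L :|: [set b; d]);
            pcoord p (L :|: [set a; d]) + pcoord p (L :|: [set b; c])] i.

Definition argmins p L a b c d : {set 'I_3} :=
  [set i | [forall j, pterm p L a b c d i <= pterm p L a b c d j]].

Definition Dr : set V :=
  [set p | forall L a b c d, admissible L a b c d ->
     (2 <= #|argmins p L a b c d|)%N].

(* Dr(k,n) is the intersection of the tropical hypersurfaces of the three-term
   relations; its fan structure is the common refinement of theirs. The smallest
   cone containing p is cut out by requiring every term that is minimal at p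
   to stay minimal, i.e. it is the closure of the set of vectors with the same
   minimal terms as p. *)
Definition cone_at p : set V :=
  [set q | forall L a b c d, admissible L a b c d ->
     argmins p L a b c d \subset argmins q L a b c d].

Definition Dr_fan : set (set V) := [set cone_at p | p in Dr].

Definition maximal_cone (C : set V) : Prop :=
  Dr_fan C /\ forall C', Dr_fan C' -> C `<=` C' -> C' = C.

Definition lineality_map (x : point_space R n) : V :=
  [ffun I : ksubset k n => \sum_(i in val I) x i : R^o].

Fact lineality_map_is_linear : linear lineality_map.
Proof.
move=> a x y; apply/ffunP => I; rewrite !ffunE scaler_sumr -big_split /=.
by apply: eq_bigr => i _; rewrite !ffunE.
Qed.

HB.instance Definition _ := GRing.isLinear.Build R (point_space R n) V _
  lineality_map lineality_map_is_linear.

Definition lineality : {vspace V} := limg (linfun lineality_map).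

Lemma linealityP p : reflect (exists x, p = lineality_map x) (p \in lineality).
Proof.
apply: (iffP memv_imgP) => [[x _ ->]|[x ->]]; exists x; rewrite ?lfunE //.
exact: memvf.
Qed.

Local Notation Q := (vquot lineality).
Local Notation proj := (vproj lineality).

(* The lattice of R^(n choose k) / lineality is the image of Z^(n choose k). *)
Definition quot_lattice : set Q :=
  [set proj p | p in [set p : V | forall I, (p I : R) \is a Num.int]].

Definition primitive_vector (v : Q) : Prop :=
  quot_lattice v /\
  forall (m : nat) (w : Q), quot_lattice w -> v = w *+ m -> m = 1%N.

(* v spans a ray of the fan modulo lineality: some cone of the fan has the
   half-line of v as its image in the quotient. *)
Definition generates_ray (v : Q) : Prop :=
  v != 0 /\ exists2 C, Dr_fan C & proj @` C = [set t *: v | t in [set t : R | 0 <= t]].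

Definition Dr_rays : set Q := [set v | generates_ray v /\ primitive_vector v].

Definition compatible (u v : Q) : Prop := (proj @` Dr) (u + v).

Definition compatible_collection (S : {fset Q}) : Prop :=
  [set` S] `<=` Dr_rays /\ {in S &, forall u v, compatible u v}.

Definition maximal_compatible (S : {fset Q}) : Prop :=
  compatible_collection S /\
  forall S' : {fset Q}, compatible_collection S' -> (S `<=` S')%fset -> S' = S.

(* The cone spanned by S modulo lineality, as a subset of R^(n choose k). *)
Definition spanned_cone (S : {fset Q}) : set V :=
  [set p | exists2 t : Q -> R, {in S, forall v, 0 <= t v}
                             & proj p = \sum_(v <- S) t v *: v].

End Dressian.

Arguments maximal_cone {R k n} C.
Arguments maximal_compatible {R k n} S.
Arguments spanned_cone {R k n} S.

(* Main.v *)
(** A vector lies in the Dressian when each three-term relation has at least two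
minimal terms out of three. The sets of minimal terms of two points of the
Dressian therefore always meet, the minimal terms of their sum are the common
ones, and two points are compatible iff for every relation these sets share at
least two elements. Since two-element subsets of a three-element set sharing
two elements are equal, a pairwise compatible family has two common minimal
terms in every relation: its sum is in the Dressian and the cone of the sum
contains the whole family. So compatible collections of rays are the
collections of rays of a common cone.

The vectors for which all terms of each relation are equal form exactly the
lineality space, so every cone is pointed modulo lineality and is generated by
its rays. The linear span of a ray is cut out by integral equations, hence a
ray contains a lattice point; as the differences of terms are integral
functionals separating points modulo lineality, it contains a unique primitive
one. Finally a ray is determined by its minimal terms, so there are finitely
many. *)

Require Import Defs.
From mathcomp Require Import all_boot all_order all_algebra.
From mathcomp Require Import finmap.
From mathcomp Require Import boolp classical_sets cardinality reals.
From mathcomp Require Import ring lra zify.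
Set Implicit Arguments.
Unset Strict Implicit.
Unset Printing Implicit Defensive.

Import Order.TTheory GRing.Theory Num.Theory.
Local Open Scope ring_scope.

(** * Functions on k-subsets and exchange of elements *)

(** Replacing an element of [I :\: J] by one of [J :\: I] keeps the value of [f] and brings [I]
    closer to [J]. *)
Lemma exchange_const (T : finType) (S : Type) (X : {set T}) (m : nat)
    (f : {set T} -> S) :
  (forall (A : {set T}) a b, A \subset X -> a \in X -> b \in X ->
     #|A|.+1 = m -> a \notin A -> b \notin A -> f (a |: A) = f (b |: A)) ->
  forall I J : {set T}, I \subset X -> J \subset X -> #|I| = m -> #|J| = m ->
    f I = f J.
Proof.
move=> fX I J; move: {2}#|I :\: J| (leqnn #|I :\: J|) => e.
elim: e I => [|e IHe] I leIJ IX JX Im Jm.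
  suff -> : I = J by [].
  apply/eqP; rewrite eqEcard Im Jm leqnn andbT -finset.setD_eq0 -cards_eq0.
  by rewrite -leqn0.
have [IJ|] := eqVneq (I :\: J) finset.set0.
  by apply: IHe => //; rewrite IJ cards0.
case/finset.set0Pn=> a; rewrite inE => /andP[aJ aI].
have : J :\: I != finset.set0.
  apply: contraNneq aJ => JI0; suff -> : J = I by [].
  by apply/eqP; rewrite eqEcard Im Jm leqnn andbT -finset.setD_eq0 JI0.
case/finset.set0Pn=> b; rewrite inE => /andP[bI bJ].
have aX := fintype.subsetP IX _ aI; have bX := fintype.subsetP JX _ bJ.
have IaX : I :\ a \subset X by apply: fintype.subset_trans IX; apply: finset.subD1set.
have Ia : (#|I :\ a|.+1 = m)%N by rewrite -Im (cardsD1 a I) aI.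
have bIa : b \notin I :\ a by rewrite !inE negb_and bI orbT.
rewrite -(finset.setD1K aI) (fX _ a b) //; last by rewrite !inE eqxx.
apply: IHe => //.
- apply: leq_trans (_ : (#|(I :\: J) :\ a| <= e)%N).
    apply/subset_leq_card/fintype.subsetP => x; rewrite !inE.
    case/andP=> xJ /orP[/eqP xb|/andP[-> ->]]; last by rewrite xJ.
    by rewrite xb bJ in xJ.
  by move: leIJ; rewrite (cardsD1 a (I :\: J)) !inE aJ aI.
- by rewrite finset.subUset finset.sub1set bX.
- by rewrite cardsU1 bIa -Ia.
Qed.

(** By the relations, [f (a |: A) - f (b |: A)] does not depend on [A]. These differences define
    weights, and [f] minus the sum of the weights is invariant under exchange, hence constant. *)
Lemma exchange_additive (F : numFieldType) (T : finType) (k : nat)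
    (f : {set T} -> F) : (0 < k)%N ->
  (forall (L : {set T}) a b c d, #|L|.+2 = k -> uniq [:: a; b; c; d] ->
     [disjoint L & [set a; b; c; d]%SET] ->
     f (L :|: [set a; c]) + f (L :|: [set b; d]) =
     f (L :|: [set a; d]) + f (L :|: [set b; c])) ->
  exists x : T -> F, forall I : {set T}, #|I| = k -> f I = \sum_(i in I) x i.
Proof.
move=> k_gt0 fE.
have [I0 /eqP I0k|noI] := pickP (fun I : {set T} => #|I| == k); last first.
  by exists (fun=> 0) => I /eqP; rewrite noI.
have [o oI0] : exists o, o \in I0 by apply/card_gt0P; rewrite I0k.
have dE (A B : {set T}) a b : #|A|.+1 = k -> #|B|.+1 = k ->
    a \notin A -> b \notin A -> a \notin B -> b \notin B ->
    f (a |: A) - f (b |: A) = f (a |: B) - f (b |: B).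
  move=> Ak Bk aA bA aB bB; have [->|neq_ab] := eqVneq a b; first by rewrite !subrr.
  pose X := ~: [set a; b]%SET.
  have sX (C : {set T}) : a \notin C -> b \notin C -> C \subset X.
    move=> aC bC; apply/fintype.subsetP => x xC; rewrite !inE negb_or.
    by apply/andP; split; [apply: contraNneq aC | apply: contraNneq bC] => <-.
  apply: (@exchange_const _ _ X k.-1 (fun A => f (a |: A) - f (b |: A))).
  - move=> C c d CX cX dX Ck cC dC.
    have [->//|neq_cd] := eqVneq c d.
    move: cX dX; rewrite !inE !negb_or => /andP[ca cb] /andP[da db].
    have aC : a \notin C by apply/negP => /(fintype.subsetP CX); rewrite !inE eqxx.
    have bC : b \notin C.
      by apply/negP => /(fintype.subsetP CX); rewrite !inE eqxx orbT.
    have := fE C a b c d; rewrite Ck prednK // => /(_ erefl).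
    rewrite /= !inE !negb_or neq_ab neq_cd ![a == _]eq_sym ![b == _]eq_sym.
    rewrite ca cb da db => /(_ erefl).
    have dis : [disjoint C & [set a; b; c; d]%SET].
      rewrite finset.disjoints_subset; apply/fintype.subsetP => x xC; rewrite !inE !negb_or.
      by rewrite -!andbA; apply/and4P; split; [apply: contraNneq aC
        | apply: contraNneq bC | apply: contraNneq cC | apply: contraNneq dC] => <-.
    move=> /(_ dis).
    have sE x y : C :|: [set x; y]%SET = x |: (y |: C).
      by rewrite finset.setUC -finset.setUA.
    by rewrite !sE => /eqP H; apply/eqP; rewrite subr_eq addrAC eq_sym subr_eq eq_sym H.
  - exact: sX.
  - exact: sX.
  - by rewrite -Ak.
  - by rewrite -Bk.
(* Weights relative to the base point [o]; the default 0 occurs only if no suitable [A] exists. *)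
pose y a := if [pick A : {set T} | [&& #|A|.+1 == k, a \notin A & o \notin A]]
  is Some A then f (a |: A) - f (o |: A) else 0.
have yE (A : {set T}) a : #|A|.+1 = k -> a \notin A -> o \notin A ->
    y a = f (a |: A) - f (o |: A).
  move=> Ak aA oA; rewrite /y; case: pickP => [B /and3P[/eqP Bk aB oB]|/(_ A)].
    exact: dE.
  by rewrite Ak eqxx aA oA.
have fy (A : {set T}) a b : #|A|.+1 = k -> a \notin A -> b \notin A ->
    f (a |: A) - f (b |: A) = y a - y b.
  move=> Ak aA bA; have [oA|oA] := boolP (o \in A); last first.
    by rewrite (yE A a) // (yE A b) // opprB addrA subrK.
  have [->|neq_ab] := eqVneq a b; first by rewrite !subrr.
  have ao : a != o by apply: contraNneq aA => ->.
  have bo : b != o by apply: contraNneq bA => ->.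
  (* For [o] in [A], [y a] is computed on [b |: L] and [y b] on [a |: L], so that the value at [L]
     with [a] and [b] cancels. *)
  pose L := A :\ o.
  have Lk : #|L|.+2 = k by rewrite -Ak (cardsD1 o A) oA.
  have aL : a \notin L by rewrite !inE negb_and aA orbT.
  have bL : b \notin L by rewrite !inE negb_and bA orbT.
  have oL : o \notin L by rewrite !inE eqxx.
  have bLk : #|b |: L|.+1 = k by rewrite cardsU1 bL.
  have aLk : #|a |: L|.+1 = k by rewrite cardsU1 aL.
  have abL : a \notin b |: L by rewrite in_setU1 negb_or neq_ab.
  have baL : b \notin a |: L by rewrite in_setU1 negb_or eq_sym neq_ab.
  have obL : o \notin b |: L by rewrite in_setU1 negb_or eq_sym bo.
  have oaL : o \notin a |: L by rewrite in_setU1 negb_or eq_sym ao.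
  rewrite (yE (b |: L) a) // (yE (a |: L) b) //.
  rewrite -(finset.setD1K oA) -/L (finset.setUCA [set b]%SET [set a]%SET).
  rewrite !(finset.setUCA [set o]%SET).
  by rewrite opprB [RHS]addrC addrA subrK.
pose g (I : {set T}) := f I - \sum_(i in I) y i.
have gc (I : {set T}) : #|I| = k -> g I = g I0.
  move=> Ik; apply: (@exchange_const _ _ [set: T]%SET k g) => //;
    rewrite ?finset.subsetT //.
  move=> A a b _ _ _ Ak aA bA; rewrite /g !big_setU1 //= !opprD !addrA.
  have /eqP := fy _ _ _ Ak aA bA; rewrite subr_eq => /eqP ->; ring.
(* The remaining constant is shared equally among the [k] elements of [I]. *)
exists (fun i => y i + g I0 / k%:R) => I Ik.
rewrite big_split /= sumr_const Ik -(mulr_natr (g I0 / k%:R)) divfK ?pnatr_eq0 -?lt0n //.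
by rewrite -(gc I) // /g addrC subrK.
Qed.

(** * Rational and integral vectors in kernels *)

Lemma rat_common_denominator (X : finType) (w : X -> rat) :
  exists c : int, c != 0 /\ forall x, exists z : int, z%:~R = w x * c%:~R.
Proof.
exists (\prod_x denq (w x)); split.
  by apply/prodf_neq0 => x _; rewrite denq_neq0.
move=> x; exists (numq (w x) * \prod_(y | y != x) denq (w y)).
by rewrite [in RHS](bigD1 x) //= !intrM numqE mulrA.
Qed.

(* The kernel of a rational matrix is spanned by rational vectors, and a
   functional that does not vanish on it does not vanish on one of these. *)
Lemma integral_kernel_vector (R : realFieldType) (X Y : finType)
    (A : X -> Y -> int) (B : X -> int) (p : X -> R) :
  (forall y, \sum_x p x * (A x y)%:~R = 0) -> \sum_x p x * (B x)%:~R != 0 ->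
  exists w : X -> int, (forall y, \sum_x w x * A x y = 0) /\
                       \sum_x w x * B x != 0.
Proof.
move=> pA pB.
pose MA : 'M[rat]_(#|X|, #|Y|) :=
  \matrix_(i, j) (A (enum_val i) (enum_val j))%:~R.
pose MB : 'cV[rat]_#|X| := \col_i (B (enum_val i))%:~R.
pose Mp : 'rV[R]_#|X| := \row_i p (enum_val i).
have sumE (S : nmodType) (F : X -> S) : 
    \sum_(i < #|X|) F (enum_val i) = \sum_x F x.
  rewrite [RHS](reindex (fun i : 'I_#|X| => enum_val i)) //.
  exact/onW_bij/enum_val_bij.
have pMA : Mp *m map_mx (ratr : rat -> R) MA = 0.
  apply/matrixP => i j; rewrite !mxE -[RHS](pA (enum_val j)) -sumE.
  by apply: eq_bigr => x _; rewrite !mxE ratr_int.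
have : (Mp <= kermx (map_mx (ratr : rat -> R) MA))%MS by apply/sub_kermxP.
(* Kernels commute with the field extension from [rat] to [R], so [p] is a combination over [R] of
   rational kernel vectors. *)
rewrite -map_kermx => /submxP[u Mpu].
have : kermx MA *m MB != 0.
  apply: contraNneq pB => kB.
  have : (Mp *m map_mx (ratr : rat -> R) MB) 0 0 = 0.
    by rewrite Mpu -mulmxA -map_mxM kB map_mx0 mulmx0 mxE.
  rewrite !mxE => pMB; apply/eqP; rewrite -[RHS]pMB -sumE.
  apply: eq_bigr => x _.
  by rewrite !mxE ratr_int.
case/matrix0Pn=> i [j]; rewrite mxE => kB.
pose w0 x := kermx MA i (enum_rank x).
have [c [c_neq0 /choice[w wE]]] := rat_common_denominator w0.
have wM (F : X -> int) : ((\sum_x w x * F x)%:~R : rat) =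
    (\sum_l kermx MA i l * (F (enum_val l))%:~R) * c%:~R.
  rewrite rmorph_sum /= -sumE mulr_suml; apply: eq_bigr => l _.
  by rewrite rmorphM /= wE /w0 enum_valK mulrAC.
exists w; split=> [y|].
  apply/eqP; rewrite -(intr_eq0 rat) wM.
  have /matrixP/(_ i (enum_rank y)) := mulmx_ker MA.
  rewrite mxE [X in _ = X -> _]mxE => kA.
  rewrite (_ : \sum_l _ = 0) ?mul0r // -[RHS]kA; apply: eq_bigr => l _.
  by rewrite [MA l _]mxE enum_rankK.
rewrite -(intr_eq0 rat) wM mulf_neq0 ?intr_eq0 //.
apply: contra_neq kB => sB; rewrite -[RHS]sB; apply: eq_bigr => l _.
by rewrite [MB l j]mxE.
Qed.

(** * Terms of the relations and the lineality space *)

Definition admissible_tuple (k n : nat)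
    (s : {set 'I_n} * 'I_n * 'I_n * 'I_n * 'I_n) : bool :=
  let: (L, a, b, c, d) := s in admissible k L a b c d.

Notation three_term k n := {s | @admissible_tuple k n s}.

Section Terms.
Variables (R : realType) (k n : nat).
Local Notation V := (plucker_space R k n).
Implicit Types (p q w : V).

Implicit Types (s : three_term k n) (i j : 'I_3).

Definition term p s i : R :=
  let: (L, a, b, c, d) := val s in pterm p L a b c d i.

Definition minterms p s : {set 'I_3} :=
  [set i | [forall j, term p s i <= term p s j]].

Lemma mintermsP p s i :
  reflect (forall j, term p s i <= term p s j) (i \in minterms p s).
Proof. by rewrite inE; apply: forallP. Qed.

Lemma argmins_minterms p L a b c d (adm : admissible k L a b c d) :
  argmins p L a b c d = minterms p (exist _ (L, a, b, c, d) adm).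
Proof. by []. Qed.

Lemma DrP p : Dr p <-> forall s, (2 <= #|minterms p s|)%N.
Proof.
split=> [Dp [[[[[L a] b] c] d] adm]|Dp L a b c d adm]; first exact: Dp.
by rewrite (argmins_minterms _ adm).
Qed.

Lemma cone_atP p q : cone_at p q <-> forall s, minterms p s \subset minterms q s.
Proof.
split=> [Cq [[[[[L a] b] c] d] adm]|Cq L a b c d adm]; first exact: Cq.
by rewrite !(argmins_minterms _ adm).
Qed.

(** The coefficients of [term] as a linear form; their integrality later yields lattice points on
    the rays. *)
Definition term_coef s i (I : ksubset k n) : int :=
  let: (L, a, b, c, d) := val s in
  nth 0 [:: (val I == L :|: [set a; b])%:R + (val I == L :|: [set c; d])%:R;
            (val I == L :|: [set a; c])%:R + (val I == L :|: [set b; d])%:R;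
            (val I == L :|: [set a; d])%:R + (val I == L :|: [set b; c])%:R] i.

Lemma pcoordE p (A : {set 'I_n}) :
  pcoord p A = \sum_I (p I : R) * (val I == A)%:R.
Proof.
rewrite /pcoord; case: insubP => [I _ <-|nA] /=.
  rewrite (bigD1 I) //= eqxx mulr1 big1 ?addr0 // => J JI.
  by rewrite (inj_eq val_inj) (negPf JI) mulr0.
rewrite big1 // => I _; have [IA|] := eqVneq; last by rewrite mulr0.
by rewrite -IA (valP I) in nA.
Qed.

Lemma termE p s i : term p s i = \sum_I (p I : R) * (term_coef s i I)%:~R.
Proof.
rewrite /term /term_coef /pterm; case: (val s) => [[[[L a] b] c] d] /=.
by case: i => [[|[|[|i]]] //= lti]; rewrite !pcoordE -big_split /=;
  apply: eq_bigr => I _; rewrite rmorphD /= !mulrz_nat mulrDr.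
Qed.

Lemma termD p q s i : term (p + q) s i = term p s i + term q s i.
Proof. by rewrite !termE -big_split; apply: eq_bigr => I _; rewrite ffunE mulrDl. Qed.

Lemma termZ (t : R) p s i : term (t *: p) s i = t * term p s i.
Proof. by rewrite !termE mulr_sumr; apply: eq_bigr => I _; rewrite ffunE mulrA. Qed.

Lemma termN p s i : term (- p) s i = - term p s i.
Proof. by rewrite -scaleN1r termZ mulN1r. Qed.

Lemma termB p q s i : term (p - q) s i = term p s i - term q s i.
Proof. by rewrite termD termN. Qed.

Definition flat p : Prop := forall s i j, term p s i = term p s j.

(** On the image of [lineality_map] all three terms equal twice the sum over [L] plus the four other
    values. Conversely, equality of the last two terms is the hypothesis of [exchange_additive]. *)
Lemma mem_lineality p : (0 < k)%N -> p \in lineality R k n <-> flat p.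
Proof.
move=> k_gt0; split=> [/linealityP[x ->]|pf].
  case=> [[[[[L a] b] c] d] adm]; have /and3P[/eqP Lk abcd dis] := adm.
  suff E i : term (lineality_map k x) (exist _ (L, a, b, c, d) adm) i =
      \sum_(l in L) x l + \sum_(l in L) x l + (x a + x b + x c + x d).
    by move=> i j; rewrite !E.
  have cE y z : y \in [set a; b; c; d]%SET -> z \in [set a; b; c; d]%SET -> y != z ->
      pcoord (lineality_map k x) (L :|: [set y; z]) =
      \sum_(l in L) x l + (x y + x z).
    move=> yA zA yz.
    have yL : y \notin L by apply: contraL yA => yL; rewrite (disjointFr dis).
    have zL : z \notin L by apply: contraL zA => zL; rewrite (disjointFr dis).
    have yzL : y \notin z |: L by rewrite in_setU1 negb_or yz.
    have -> : L :|: [set y; z]%SET = y |: (z |: L).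
      by rewrite finset.setUC -finset.setUA.
    have Ak : #|y |: (z |: L)| == k by rewrite cardsU1 yzL cardsU1 zL -Lk.
    rewrite /pcoord (insubT (fun I : {set 'I_n} => #|I| == k) Ak) /= ffunE /=.
    by rewrite !big_setU1 //= [RHS]addrC addrA.
  move: abcd; rewrite /= !inE !negb_or => /and4P[/and3P[ab ac ad] /andP[bc bd] cd _].
  case: i => [[|[|[|i]]] //= lti]; rewrite /term /= /pterm /= !cE;
    rewrite ?inE ?eqxx ?orbT //; ring.
have [|x xE] := exchange_additive (f := pcoord p) k_gt0.
  move=> L a b c d Lk abcd dis.
  have adm : admissible_tuple k (L, a, b, c, d).
    by rewrite /= /admissible Lk eqxx abcd dis.
  by have := pf (exist _ (L, a, b, c, d) adm) (inord 1) (inord 2);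
    rewrite /term /pterm /= !inordK.
apply/linealityP; exists [ffun i => x i : R^o]; apply/ffunP => I.
rewrite ffunE; under eq_bigr do rewrite ffunE.
rewrite -xE; last exact/eqP/(valP I).
by rewrite /pcoord valK.
Qed.

End Terms.

(** * Minimal terms and the cones of the fan *)

Lemma card_meet (T : finType) (A B : {set T}) :
  (#|T| < #|A| + #|B|)%N -> exists x, x \in A :&: B.
Proof.
move=> ltT; apply/card_gt0P; have := cardsUI A B.
by have := max_card (A :|: B); lia.
Qed.

Section Cones.
Variables (R : realType) (k n : nat).
Local Notation V := (plucker_space R k n).
Implicit Types (p q u v w : V) (s : three_term k n) (i j : 'I_3) (t : R).

Lemma mintermsE p s i j : i \in minterms p s ->
  (j \in minterms p s) = (term p s j == term p s i).
Proof.
move=> /mintermsP ip; apply/mintermsP/eqP => [jp|-> //].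
by apply/eqP; rewrite eq_le ip jp.
Qed.

Lemma exists_minterm p s : exists i, i \in minterms p s.
Proof.
exists [arg min_(i < ord0) term p s i]%O; case: arg_minP => // i _ ip.
by apply/mintermsP => j; apply: ip.
Qed.

Lemma flat_minterms p : flat p <-> forall s, minterms p s = [set: 'I_3]%SET.
Proof.
split=> [fp s|fp s i j].
  by apply/setP => i; rewrite finset.in_setT; apply/mintermsP => j; rewrite (fp s i j).
by apply/eqP; rewrite -mintermsE fp inE.
Qed.

Lemma flat0 : flat (0 : V).
Proof. by move=> s i j; rewrite -(scale0r (0 : V)) !termZ !mul0r. Qed.

Lemma flatN p : flat p -> flat (- p).
Proof. by move=> fp s i j; rewrite !termN (fp s i j). Qed.

Lemma flatZ t p : flat p -> flat (t *: p).
Proof. by move=> fp s i j; rewrite !termZ (fp s i j). Qed.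

Lemma flatZ_inv t p : t != 0 -> flat (t *: p) -> flat p.
Proof. by move=> t0 fp; rewrite -(scalerK t0 p); apply: flatZ. Qed.

Lemma minterms_flatD p q : flat q -> minterms (p + q) =1 minterms p.
Proof.
move=> fq s; apply/setP => i; apply/mintermsP/mintermsP => ip j; move: (ip j);
  by rewrite !termD (fq s i j) lerD2r.
Qed.

Lemma mintermsZ t p : 0 < t -> minterms (t *: p) =1 minterms p.
Proof.
move=> t0 s; apply/setP => i; apply/mintermsP/mintermsP => ip j; move: (ip j);
  by rewrite !termZ ler_pM2l.
Qed.

Lemma minterms_subD p q s :
  minterms p s :&: minterms q s \subset minterms (p + q) s.
Proof.
apply/fintype.subsetP => i; rewrite inE => /andP[/mintermsP ip /mintermsP iq].
by apply/mintermsP => j; rewrite !termD lerD.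
Qed.

(** At a common minimal term the inequalities for [p] and [q] add up, and equality in the sum forces
    equality in both. *)
Lemma mintermsD p q s i : i \in minterms p s :&: minterms q s ->
  minterms (p + q) s = minterms p s :&: minterms q s.
Proof.
move=> ipq; apply/eqP; rewrite finset.eqEsubset minterms_subD andbT.
apply/fintype.subsetP => j.
rewrite (mintermsE _ (fintype.subsetP (minterms_subD p q s) i ipq)) => /eqP.
move: ipq; rewrite !finset.in_setI => /andP[ip iq]; rewrite !termD => E.
 have /mintermsP/(_ j) ipj := ip; have /mintermsP/(_ j) iqj := iq.
have pE : term p s j = term p s i by lra.
have qE : term q s j = term q s i by lra.
by rewrite (mintermsE _ ip) (mintermsE _ iq) pE qE !eqxx.
Qed.

Lemma Dr_minterm p q s : Dr p -> Dr q ->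
  exists i, i \in minterms p s :&: minterms q s.
Proof.
move=> /DrP/(_ s) p2 /DrP/(_ s) q2; apply: card_meet.
by rewrite card_ord; apply: leq_trans (leq_add p2 q2).
Qed.

Lemma cone_at_refl p : cone_at p p.
Proof. by apply/cone_atP. Qed.

Lemma cone_at_trans p q w : cone_at p q -> cone_at q w -> cone_at p w.
Proof.
move=> /cone_atP pq /cone_atP qw; apply/cone_atP => s.
exact: fintype.subset_trans (pq s) (qw s).
Qed.

Lemma cone_at_Dr p q : Dr p -> cone_at p q -> Dr q.
Proof.
move=> /DrP Dp /cone_atP pq; apply/DrP => s.
exact: leq_trans (Dp s) (subset_leq_card (pq s)).
Qed.

Lemma flat_cone_at p q : flat q -> cone_at p q.
Proof. by move=> /flat_minterms fq; apply/cone_atP => s; rewrite fq finset.subsetT. Qed.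

Lemma cone_atD p q w : cone_at p q -> cone_at p w -> cone_at p (q + w).
Proof.
move=> /cone_atP pq /cone_atP pw; apply/cone_atP => s.
by apply: fintype.subset_trans (minterms_subD q w s); rewrite finset.subsetI pq pw.
Qed.

Lemma cone_atZ p t q : 0 <= t -> cone_at p q -> cone_at p (t *: q).
Proof.
rewrite le_eqVlt => /predU1P[<- _|t0 /cone_atP pq].
  by rewrite scale0r; apply/flat_cone_at/flat0.
by apply/cone_atP => s; rewrite mintermsZ.
Qed.

(** A term minimal at [p] is minimal for both [q] and [- q], so it is also maximal for [q]. *)
Lemma cone_at_pointed p q : cone_at p q -> cone_at p (- q) -> flat q.
Proof.
move=> /cone_atP pq /cone_atP pNq s.
have [l lp] := exists_minterm p s.
have /mintermsP lq := fintype.subsetP (pq s) _ lp.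
have /mintermsP lNq := fintype.subsetP (pNq s) _ lp.
suff E i : term q s i = term q s l by move=> i j; rewrite !E.
by apply/eqP; rewrite eq_le lq andbT; have := lNq i; rewrite !termN lerN2.
Qed.

(* Two-element subsets of a three-element set meet in two elements only if
   they coincide; this is why pairwise compatibility is enough. *)
Lemma pairwise_meet_I3 (As : seq {set 'I_3}) :
  {in As &, forall A B : {set 'I_3}, (2 <= #|A :&: B|)%N} ->
  exists2 A0 : {set 'I_3}, (2 <= #|A0|)%N & {in As, forall A : {set 'I_3}, A0 \subset A}.
Proof.
move=> As2; have [/hasP[A0 A0s /eqP A02]|/hasPn noA] :=
    boolP (has (fun A : {set 'I_3} => #|A| == 2) As).
  exists A0 => [|A As_A]; first by rewrite A02.
  apply/finset.setIidPl/eqP; rewrite eqEcard finset.subsetIl A02; exact: As2.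
exists [set: 'I_3]%SET => [|A As_A]; first by rewrite cardsT card_ord.
have /eqP <- : A == [set: 'I_3]%SET; last by [].
rewrite eqEcard finset.subsetT cardsT card_ord.
have := As2 A A As_A As_A; rewrite finset.setIid.
by have := noA A As_A; lia.
Qed.

(** In each relation a common set [A0] of at least two minimal terms survives every addition, while
    the minimal terms of the sum stay inside those of each summand. *)
Lemma pairwise_Dr_sum (ps : seq V) :
  {in ps &, forall p q, Dr (p + q)} -> {in ps, forall p, Dr p} ->
  Dr (\sum_(p <- ps) p) /\ {in ps, forall p, cone_at (\sum_(p <- ps) p) p}.
Proof.
move=> Dps2 Dps.
have sumE s : exists2 A0 : {set 'I_3}, (2 <= #|A0|)%N &
    A0 \subset minterms (\sum_(p <- ps) p) s /\
    {in ps, forall p, minterms (\sum_(p <- ps) p) s \subset minterms p s}.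
  have [|A0 A02 A0s] := @pairwise_meet_I3 [seq minterms p s | p <- ps].
    move=> _ _ /mapP[p pps ->] /mapP[q qps ->].
    have [i ipq] := Dr_minterm s (Dps _ pps) (Dps _ qps).
    by rewrite -(mintermsD ipq); have /DrP := Dps2 _ _ pps qps.
  exists A0 => //.
  have {}A0s : {in ps, forall p, A0 \subset minterms p s}.
    by move=> p pps; apply/A0s/map_f.
  (* This element is the common minimal term that [mintermsD] asks for at each addition. *)
  have [a aA0] : exists a, a \in A0 by apply/card_gt0P; apply: leq_trans A02.
  elim: (ps) A0s => [|p ps' IH] A0s.
    rewrite big_nil; split=> //.
    by have /flat_minterms -> := flat0; apply: finset.subsetT.
  have [q qps|A0S subS] := IH; first by apply: A0s; rewrite inE qps orbT.
  have A0p : A0 \subset minterms p s by apply: A0s; rewrite inE eqxx.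
  rewrite big_cons (@mintermsD _ _ _ a); last first.
    by rewrite inE (fintype.subsetP A0p) ?(fintype.subsetP A0S).
  split; first by rewrite finset.subsetI A0p.
  move=> q; rewrite inE => /predU1P[->|/subS]; first exact: finset.subsetIl.
  by apply: fintype.subset_trans; apply: finset.subsetIr.
split=> [|p pps]; last first.
  by apply/cone_atP => s; have [A0 _ [_]] := sumE s; apply.
apply/DrP => s; have [A0 A02 [A0S _]] := sumE s.
exact: leq_trans A02 (subset_leq_card A0S).
Qed.

(* [w] lies in the linear span of the cone of [q]: moving from [w] against [q],
   the last point of the cone acquires a new minimal term. *)
Lemma cone_at_exit q w : ~ flat q ->
  (forall s i j, i \in minterms q s -> j \in minterms q s ->
     term w s i = term w s j) ->
  exists l : R, cone_at q (w - l *: q) /\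
    exists s i, i \notin minterms q s /\ i \in minterms (w - l *: q) s.
Proof.
move=> nfq wE.
pose P (x : three_term k n * 'I_3) := x.2 \notin minterms q x.1.
have [x0 Px0] : exists x, P x.
  apply: contrapT => noP; apply/nfq/flat_minterms => s; apply/setP => i.
  by rewrite finset.in_setT; apply/negPn/negP => ni; apply: noP; exists (s, i).
have /choice[m mP] := exists_minterm q.
pose f u (x : three_term k n * 'I_3) := term u x.1 x.2 - term u x.1 (m x.1).
have fq0 x : P x -> 0 < f q x.
  move=> Px; rewrite lt_def subr_eq0 -mintermsE // -/(P x) Px subr_ge0.
  exact: (mintermsP _ _ _ (mP x.1)).
(* A ratio test: [f] measures the excess over a minimal term of [q], and the least ratio is the
   largest [l] keeping all excesses of [w - l *: q] nonnegative, with a zero at [x1]. *)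
case: (@arg_minP _ _ _ x0 P (fun x => f w x / f q x) Px0) => x1 Px1 x1min.
pose l := f w x1 / f q x1.
have fE x : f (w - l *: q) x = f w x - l * f q x.
  by rewrite /f !termB !termZ; ring.
have fge0 x : 0 <= f (w - l *: q) x.
  rewrite fE; have [Px|] := boolP (P x).
    by rewrite subr_ge0 -ler_pdivlMr ?fq0 // x1min.
  rewrite /P negbK => xq; rewrite /f (wE _ _ _ xq (mP _)).
  move: xq; rewrite (mintermsE _ (mP _)) => /eqP ->.
  by rewrite !subrr mulr0 subrr.
have mw s : m s \in minterms (w - l *: q) s.
  by apply/mintermsP => i; have := fge0 (s, i); rewrite subr_ge0.
exists l; split.
  apply/cone_atP => s; apply/fintype.subsetP => i iq.
  rewrite (mintermsE _ (mw s)) -subr_eq0 -/(f _ (s, i)) fE /f /=.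
  rewrite (wE _ _ _ iq (mP _)).
  move: iq; rewrite (mintermsE _ (mP _)) => /eqP ->.
  by rewrite !subrr mulr0 subrr.
exists x1.1, x1.2; split=> //.
rewrite (mintermsE _ (mw _)) -subr_eq0 -/(f _ x1) fE /l divfK ?subrr //.
by rewrite gt_eqF ?fq0.
Qed.

(** [q] spans a ray modulo lineality, expressed on representatives; the sign of [t] follows in
    [ray_point_coef_ge0]. *)
Definition ray_point q : Prop :=
  ~ flat q /\ forall w, cone_at q w -> exists t, flat (w - t *: q).

(** Each cone is generated by flat vectors and ray points, by induction on the number of nonminimal
    terms. If [u] is not a ray point, moving from some [w] and from [- w] against [u] ends in points
    with more minimal terms, whose sum is a positive multiple of [u]. *)
Lemma cone_at_ray_ind (P : V -> Prop) q :
  (forall u, flat u -> P u) ->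
  (forall u, cone_at q u -> ray_point u -> P u) ->
  (forall u v, P u -> P v -> P (u + v)) ->
  (forall t u, 0 < t -> P u -> P (t *: u)) ->
  P q.
Proof.
move=> Pflat Pray PD PZ.
pose N u := [set x : three_term k n * 'I_3 | x.2 \notin minterms u x.1].
have NE u x : (x \in N u) = (x.2 \notin minterms u x.1) by rewrite finset.in_set.
suff: forall u, cone_at q u -> P u by apply; apply: cone_at_refl.
move=> u; move: {2}#|N u| (leqnn #|N u|) => e.
elim: e u => [|e IHe] u Nu qu.
  apply/Pflat/flat_minterms => s; apply/setP => i; rewrite finset.in_setT.
  apply/negPn/negP => iu; move: Nu; rewrite leqn0 cards_eq0 => /eqP/setP/(_ (s, i)).
  by rewrite NE iu finset.in_set0.
have [/Pflat //|nfu] := pselect (flat u).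
have [ru|nru] := pselect (ray_point u); first exact: Pray.
have [w uw nw] : exists2 w, cone_at u w & forall t, ~ flat (w - t *: u).
  apply: contrapT => noW; apply: nru; split=> // w uw.
  by apply: contrapT => nt; apply: noW; exists w => // t ft; apply: nt; exists t.
have wE s i j : i \in minterms u s -> j \in minterms u s ->
    term w s i = term w s j.
  move/cone_atP: uw => /(_ s)/fintype.subsetP uw /uw iw /uw.
  by rewrite (mintermsE _ iw) => /eqP.
have [l1 [C1 [s1 [i1 [i1u i1w]]]]] := cone_at_exit nfu wE.
have [|l2 [C2 [s2 [i2 [i2u i2w]]]]] := @cone_at_exit u (- w) nfu.
  by move=> s i j iu ju; rewrite !termN (wE s i j).
(* If the sum were 0, [w - l1 *: u] would be flat; if it were positive, the cone at [u] would
   contain [- u]. *)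
have l12 : l1 + l2 < 0.
  rewrite ltNge le_eqVlt; apply/negP => /predU1P[l12|l12].
    apply: (nw l1); apply: cone_at_pointed C1 _.
    have -> : - (w - l1 *: u) = - w - l2 *: u; last by [].
    rewrite (_ : l2 = - l1); last by lra.
    by rewrite scaleNr opprK opprB addrC.
  apply: nfu; apply: (@flatZ_inv (l1 + l2)); first by rewrite gt_eqF.
  apply: (@cone_at_pointed u); first exact/cone_atZ/cone_at_refl/ltW.
  rewrite (_ : - _ = (w - l1 *: u) + (- w - l2 *: u)); first exact: cone_atD.
  by rewrite addrACA subrr add0r scalerDl opprD.
have Pexit v s i : cone_at u v -> i \notin minterms u s -> i \in minterms v s -> P v.
  move=> uv iu iv; apply: IHe; last exact: cone_at_trans qu uv.
  rewrite -ltnS; apply: leq_trans Nu; apply: proper_card.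
  apply/fintype.properP; split; last by exists (s, i); rewrite NE ?iu ?iv.
  apply/fintype.subsetP => x; rewrite !NE; apply: contra.
  by move/cone_atP: uv => /(_ x.1)/fintype.subsetP; apply.
have -> : u = (- (l1 + l2))^-1 *: ((w - l1 *: u) + (- w - l2 *: u)).
  rewrite addrACA subrr add0r -opprD -scalerDl -scaleNr scalerK //.
  by rewrite oppr_eq0 lt_eqF.
apply: PZ; first by rewrite invr_gt0 oppr_gt0.
exact: PD (Pexit _ _ _ C1 i1u i1w) (Pexit _ _ _ C2 i2u i2w).
Qed.

End Cones.

(** * Rays and primitive vectors modulo lineality *)

Section Rays.
Variables (R : realType) (k n : nat).
Hypothesis k_gt0 : (0 < k)%N.
Local Notation V := (plucker_space R k n).
Local Notation Q := (vquot (lineality R k n)).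
Local Notation proj := (vproj (lineality R k n)).
Implicit Types (p q w : V) (u v : Q) (s : three_term k n) (i j : 'I_3) (t : R).

Lemma proj_eqP p q : proj p = proj q <-> flat (p - q).
Proof.
rewrite -(mem_lineality _ k_gt0) -vproj_eq.
by split=> /eqP.
Qed.

Lemma proj_eq0P p : proj p = 0 <-> flat p.
Proof. by rewrite -(raddf0 proj) proj_eqP subr0. Qed.

Lemma cone_at_proj p q w : proj q = proj w -> cone_at p q -> cone_at p w.
Proof.
move=> /esym/proj_eqP fwq pq; rewrite -(subrK q w) addrC.
exact/cone_atD/flat_cone_at.
Qed.

Lemma Dr_proj p q : proj p = proj q -> Dr p -> Dr q.
Proof.
by move=> pq Dp; apply: cone_at_Dr Dp _; apply: cone_at_proj pq (cone_at_refl p).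
Qed.

(** For negative [t] the vector [- q] would lie in the cone at [q], against pointedness. *)
Lemma ray_point_coef_ge0 q w t :
  ray_point q -> cone_at q w -> flat (w - t *: q) -> 0 <= t.
Proof.
move=> [nfq _] qw fwq; rewrite leNgt; apply/negP => t0; apply: nfq.
apply: (cone_at_pointed (cone_at_refl q)).
have -> : - q = (- t)^-1 *: (w - (w - t *: q)).
  by rewrite subKr invrN scaleNr scalerK // lt_eqF.
apply: cone_atZ; first by rewrite invr_ge0 oppr_ge0 ltW.
exact/cone_atD/flat_cone_at/flatN.
Qed.

Lemma ray_pointZ t q : 0 < t -> ray_point q -> ray_point (t *: q).
Proof.
move=> t0 [nfq rq]; split=> [/flatZ_inv|w].
  by move/(_ (lt0r_neq0 t0)).
move=> /cone_atP qw; have [|l lw] := rq w.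
  by apply/cone_atP => s; rewrite -(mintermsZ q t0).
by exists (l / t); rewrite scalerA divfK ?lt0r_neq0.
Qed.

(** If the image of [cone_at q] is the half-line of [proj p], then [q] is a positive multiple of [p]
    modulo flat vectors, so both have the same minimal terms. *)
Lemma generates_rayP p : generates_ray (proj p) <-> Dr p /\ ray_point p.
Proof.
split=> [[/eqP p0 [_ [q Dq <-] Cq]]|[Dp rp]].
  have nfp : ~ flat p by move/proj_eq0P.
  have qp : cone_at q p.
    have : [set t *: proj p | t in [set t : R | 0 <= t]]%classic (proj p).
      by exists 1; rewrite /= ?ler01 ?scale1r.
    by rewrite -Cq => -[w qw wp]; apply: cone_at_proj wp qw.
  have : (proj @` cone_at q)%classic (proj q) by exists q => //; apply: cone_at_refl.
  rewrite Cq => -[t /= t_ge0]; rewrite -linearZ => /esym/proj_eqP fqp.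
  have t_gt0 : 0 < t.
    rewrite lt_def t_ge0 andbT; apply/eqP => t0.
    move: fqp; rewrite t0 scale0r subr0 => /flat_minterms fq.
    apply/nfp/flat_minterms => s; apply/eqP.
    by have /cone_atP/(_ s) := qp; rewrite fq finset.subTset.
  split; first exact: cone_at_Dr Dq qp.
  split=> // w /cone_atP pw.
  have : (proj @` cone_at q)%classic (proj w).
    exists w => //; apply/cone_atP => s.
    by rewrite -(subrK (t *: p) q) addrC minterms_flatD // mintermsZ.
  rewrite Cq => -[t' _]; rewrite -linearZ => /esym/proj_eqP fwp.
  by exists t'.
split; first by apply/eqP => /proj_eq0P; case: rp.
exists (cone_at p); first by exists p.
apply/seteqP; split=> [_ [w pw <-]|_ [t /= t_ge0 <-]].
  have [_ /(_ w pw)[t ft]] := rp.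
  exists t; first exact: ray_point_coef_ge0 rp pw ft.
  by rewrite -linearZ; apply/esym/proj_eqP.
by exists (t *: p); rewrite ?linearZ //; apply/cone_atZ/cone_at_refl.
Qed.

Definition lift v : V := sval (cid (vproj_surj v)).

Lemma liftK : cancel lift proj.
Proof. by move=> v; rewrite /lift; case: cid. Qed.

(** Differences of terms vanish on the lineality space, so they are functionals on the quotient
    independent of [lift]; they separate points and are integral on the lattice. *)
Definition defect s i j v : R := term (lift v) s i - term (lift v) s j.

Lemma defect_proj s i j p : defect s i j (proj p) = term p s i - term p s j.
Proof.
have /proj_eqP/(_ s i j) := liftK (proj p).
by rewrite !termB /defect; lra.
Qed.

Lemma defectZ s i j t v : defect s i j (t *: v) = t * defect s i j v.
Proof. by rewrite -{1}(liftK v) -linearZ defect_proj !termZ -mulrBr. Qed.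

Lemma defect_neq0 v : v != 0 -> exists s i j, defect s i j v != 0.
Proof.
move=> v0; apply: contrapT => nd; move/eqP: v0; apply.
rewrite -(liftK v); apply/proj_eq0P => s i j; apply/eqP; rewrite -subr_eq0.
by apply/negPn/negP => ne; apply: nd; exists s, i, j.
Qed.

Lemma defect_int s i j v : quot_lattice v -> defect s i j v \is a Num.int.
Proof.
case=> p pint <-; rewrite defect_proj !termE -sumrB rpred_sum // => I _.
by rewrite rpredB ?rpredM ?intr_int //; apply: pint.
Qed.

Lemma quot_latticeD u v : quot_lattice u -> quot_lattice v -> quot_lattice (u + v).
Proof.
move=> [p pint <-] [q qint <-]; exists (p + q); last by rewrite raddfD.
by move=> I; rewrite ffunE rpredD ?pint ?qint.
Qed.

Lemma quot_latticeZ (m : int) v : quot_lattice v -> quot_lattice (m%:~R *: v).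
Proof.
move=> [p pint <-]; exists (m%:~R *: p); last by rewrite linearZ.
by move=> I; rewrite ffunE; apply: rpredM; [apply: intr_int | apply: pint].
Qed.

(** A nonzero defect of [v] is an integer divisible by every [m] such that [v = u *+ m] with [u] in
    the lattice. This bounds [m], and the largest one makes [u] primitive. *)
Lemma primitive_multiple v : v != 0 -> quot_lattice v ->
  exists m u, [/\ (0 < m)%N, primitive_vector u & v = u *+ m].
Proof.
move=> v0 vL.
pose P m := `[< exists2 u, quot_lattice u & v = u *+ m >].
have [s [i [j d0]]] := defect_neq0 v0.
have m_gt0 m u : v = u *+ m -> (0 < m)%N.
  by case: m => // vE; rewrite vE mulr0n eqxx in v0.
have /natrP[N NE] := natr_norm_int (defect_int s i j vL).
have P1 : exists m, P m by exists 1%N; apply/asboolP; exists v.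
have ubP m : P m -> (m <= N)%N.
  move/asboolP => [u uL vE].
  have /natrP[M ME] := natr_norm_int (defect_int s i j uL).
  have NM : N = (m * M)%N.
    apply/eqP; rewrite -(eqr_nat R) natrM -NE -ME vE -scaler_nat defectZ normrM.
    by rewrite normr_nat.
  have : (0 < N)%N by rewrite -(ltr_nat R) -NE normr_gt0.
  by rewrite NM muln_gt0 => /andP[m0 M0]; rewrite leq_pmulr.
case: (ex_maxnP P1 ubP) => m /asboolP[u uL vE] mmax.
exists m, u; split=> //; first exact: m_gt0 vE.
split=> // m' w wL uE.
have vE' : v = w *+ (m' * m) by rewrite vE uE mulrnA.
have Pm : P (m' * m)%N by apply/asboolP; exists w.
have := mmax _ Pm; have := m_gt0 _ _ vE'; have := m_gt0 _ _ vE.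
rewrite muln_gt0 => m0 /andP[m'0 _].
by rewrite -[X in (_ <= X)%N]mul1n leq_pmul2r //; lia.
Qed.

(** Write [t] as [b' / a'] in lowest terms. By Bezout, [u] divided by [a'] is an integral
    combination of [u] and [v], hence a lattice vector, and primitivity gives [a' = b' = 1]. *)
Lemma primitive_uniq u v t : u != 0 -> 0 < t -> v = t *: u ->
  primitive_vector u -> primitive_vector v -> v = u.
Proof.
move=> u0 t0 vE [uL uP] [vL vP].
have [s [i [j d0]]] := defect_neq0 u0.
have /natrP[a aE] := natr_norm_int (defect_int s i j uL).
have /natrP[b bE] := natr_norm_int (defect_int s i j vL).
have a_gt0 : (0 < a)%N by rewrite -(ltr_nat R) -aE normr_gt0.
have btE : b%:R = t * a%:R by rewrite -bE -aE vE defectZ normrM gtr0_norm.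
have g_gt0 : (0 < gcdn a b)%N by rewrite gcdn_gt0 a_gt0.
have [a' aE'] := dvdnP (dvdn_gcdl a b).
have [b' bE'] := dvdnP (dvdn_gcdr a b).
have a'_gt0 : (0 < a')%N by move: a_gt0; rewrite aE' muln_gt0 => /andP[].
have a'R : (a'%:R : R) != 0 by rewrite pnatr_eq0 -lt0n.
have tE : t = b'%:R / a'%:R.
  apply: (mulIf (x := a%:R)); first by rewrite pnatr_eq0 -lt0n.
  by rewrite -btE {1}bE' {2}aE' !natrM mulrA divfK.
have co : gcdn a' b' = 1%N.
  apply/eqP; rewrite -(eqn_pmul2r g_gt0) muln_gcdl -aE' -bE' mul1n.
  by [].
pose w := a'%:R^-1 *: u.
have uw : u = w *+ a' by rewrite -scaler_nat scalerA divff ?scale1r.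
have vw : v = w *+ b' by rewrite -scaler_nat scalerA -tE.
clearbody w; have wL : quot_lattice w.
  have [x [y xy]] := Bezoutz a' b'.
  have xyR : x%:~R * a'%:R + y%:~R * b'%:R = 1 :> R.
    have := congr1 (fun z : int => z%:~R : R) xy.
    by rewrite /gcdz /= co rmorphD !rmorphM.
  have -> : w = x%:~R *: u + y%:~R *: v.
    rewrite {1}uw vw -(scaler_nat a' w) -(scaler_nat b' w) !scalerA -scalerDl.
    by rewrite xyR scale1r.
  by apply: quot_latticeD; apply: quot_latticeZ.
by rewrite uw vw (uP _ _ wL uw) (vP _ _ wL vw).
Qed.

(* The linear span of the cone of a ray point is a rational subspace, and it is
   spanned by the ray point modulo the lineality space. *)
Lemma ray_point_lattice q : ray_point q ->
  exists2 t, 0 < t & quot_lattice (t *: proj q).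
Proof.
move=> [nfq rq].
have [s0 [i0 [j0 d0]]] : exists s i j, term q s i - term q s j != 0.
  have /eqP/defect_neq0[s [i [j]]] : proj q <> 0 by move/proj_eq0P.
  by rewrite defect_proj => ?; exists s, i, j.
(* The equations [A] say that the minimal terms at [q] agree, which describes the span of its cone;
   [B] is a difference of terms not vanishing at [q]. *)
pose A I (y : three_term k n * 'I_3 * 'I_3) : int :=
  let: (s, i, j) := y in
  if (i \in minterms q s) && (j \in minterms q s)
  then term_coef s i I - term_coef s j I else 0.
pose B I := term_coef s0 i0 I - term_coef s0 j0 I.
have diffE (p : V) s i j : term p s i - term p s j =
    \sum_I (p I : R) * (term_coef s i I - term_coef s j I)%:~R.
  by rewrite !termE -sumrB; apply: eq_bigr => I _; rewrite intrB mulrBr.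
have [||w [wA wB]] := @integral_kernel_vector R _ _ A B q.
- move=> [[s i] j]; rewrite /A.
  case ij: ((i \in minterms q s) && (j \in minterms q s)).
    move/andP: ij => [iq jq]; rewrite -diffE; apply/eqP; rewrite subr_eq0.
    by rewrite (mintermsE _ jq) in iq.
  by rewrite big1 // => I _; rewrite mulr0.
- by rewrite -diffE.
pose W : V := [ffun I => (w I)%:~R : R^o].
have WE s i j : term W s i - term W s j =
    (\sum_I w I * (term_coef s i I - term_coef s j I))%:~R.
  by rewrite diffE rmorph_sum /=; apply: eq_bigr => I _; rewrite ffunE intrM.
have nfW : ~ flat W.
  move=> /(_ s0 i0 j0)/eqP; rewrite -subr_eq0 WE intr_eq0.
  by rewrite (negPf wB).
(* Moving [W] along [q] into the cone shows that [W] is a multiple of [q] modulo flat vectors. *)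
have [|l [qW _]] := @cone_at_exit _ _ _ q W nfq.
  move=> s i j iq jq; apply/eqP; rewrite -subr_eq0 WE intr_eq0.
  by have := wA (s, i, j); rewrite /A iq jq => /eqP.
have [t ft] := rq _ qW.
have WL : quot_lattice (proj W).
  by exists W => // I; rewrite ffunE intr_int.
have WqE : proj W = (l + t) *: proj q.
  by rewrite -linearZ; apply/proj_eqP; rewrite scalerDl opprD addrA.
have lt0 : l + t != 0.
  by apply/eqP => lt0; apply: nfW; apply/proj_eq0P; rewrite WqE lt0 scale0r.
have [lt_neg|lt_pos] := ltP (l + t) 0.
  exists (- (l + t)); first by rewrite oppr_gt0.
  by rewrite scaleNr -WqE -scaleN1r; apply: (quot_latticeZ (-1)).
by exists (l + t); rewrite -?WqE // lt_def lt0.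
Qed.

Lemma ray_point_primitive q : Dr q -> ray_point q ->
  exists2 t, 0 < t & Dr_rays (t *: proj q).
Proof.
move=> Dq rq; have [t t0 tL] := ray_point_lattice rq.
have [|m [u [m0 uP uE]]] := primitive_multiple _ tL.
  rewrite scaler_eq0 gt_eqF //=; apply/eqP => /proj_eq0P; exact: rq.1.
have m0R : 0 < (m%:R : R) by rewrite ltr0n.
exists (t / m%:R); first by rewrite divr_gt0.
have -> : (t / m%:R) *: proj q = u.
  by rewrite mulrC -scalerA uE -scaler_nat scalerK // gt_eqF.
split=> //.
have <- : proj ((t / m%:R) *: q) = u.
  by rewrite linearZ /= mulrC -scalerA uE -scaler_nat scalerK // gt_eqF.
apply/generates_rayP; split; last by apply: ray_pointZ; rewrite ?divr_gt0.
by apply: cone_at_Dr Dq _; apply/cone_atZ/cone_at_refl; rewrite divr_ge0 // ltW.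
Qed.

Lemma Dr_rays_lift v : Dr_rays v -> Dr (lift v) /\ ray_point (lift v).
Proof. by case=> gv _; apply/generates_rayP; rewrite liftK. Qed.

(** Equal minimal terms put one representative in the cone of the other, so [v] is a positive
    multiple of [u]. *)
Lemma Dr_rays_inj u v : Dr_rays u -> Dr_rays v ->
  minterms (lift u) =1 minterms (lift v) -> v = u.
Proof.
move=> uR vR uv; have [Du ru] := Dr_rays_lift uR; have [Dv rv] := Dr_rays_lift vR.
have Cv : cone_at (lift u) (lift v) by apply/cone_atP => s; rewrite uv.
have [t ft] := ru.2 _ Cv.
have t0 : 0 <= t := ray_point_coef_ge0 ru Cv ft.
have vE : v = t *: u by rewrite -(liftK v) -(liftK u) -linearZ; apply/proj_eqP.
have [[u0 _] uP] := uR; have [[v0 _] vP] := vR.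
apply: (primitive_uniq u0 _ vE uP vP); rewrite lt_def t0 andbT.
by apply: contraNneq v0 => t00; rewrite vE t00 scale0r.
Qed.

(** Choosing one ray for each assignment of minimal terms that occurs covers all rays, by
    [Dr_rays_inj]. *)
Lemma finite_Dr_rays : finite_set (@Dr_rays R k n).
Proof.
pose T := {ffun three_term k n -> {set 'I_3}}.
pose rays_of (f : T) : set Q :=
  [set v | Dr_rays v /\ minterms (lift v) =1 f]%classic.
pose g (f : T) : Q := xget 0 (rays_of f).
apply: (@sub_finite_set _ _ (range g)); last exact/finite_image/finite_finset.
move=> v vR; pose f : T := [ffun s => minterms (lift v) s]; exists f => //.
have fv : rays_of f v by split=> // s; rewrite ffunE.
have : rays_of f (g f) := xgetI 0 fv.
by case=> gR gE; apply: Dr_rays_inj => // s; rewrite gE ffunE.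
Qed.

End Rays.

(** * Maximal cones and maximal compatible collections *)

Section MaximalCones.
Variables (R : realType) (k n : nat).
Hypothesis k_gt0 : (0 < k)%N.
Local Notation V := (plucker_space R k n).
Local Notation Q := (vquot (lineality R k n)).
Local Notation proj := (vproj (lineality R k n)).
Implicit Types (p q w : V) (u v : Q) (t : R) (S : {fset Q}).

(** [fset_set] returns the intended set because there are finitely many rays. *)
Definition cone_rays (C : set V) : {fset Q} :=
  fset_set [set v | Dr_rays v /\ C (lift v)]%classic.

Lemma cone_raysP (C : set V) v : v \in cone_rays C <-> Dr_rays v /\ C (lift v).
Proof.
rewrite /cone_rays in_fset_set; last first.
  by apply: sub_finite_set (finite_Dr_rays R n k_gt0) => u [].
by split=> [/set_mem|] //; move=> ?; apply/mem_set.
Qed.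

Lemma spanned_cone_flat S p : flat p -> spanned_cone S p.
Proof.
move=> /(proj_eq0P k_gt0) p0; exists (fun=> 0) => //.
by rewrite p0 big1 // => v _; rewrite scale0r.
Qed.

Lemma spanned_coneD S p q :
  spanned_cone S p -> spanned_cone S q -> spanned_cone S (p + q).
Proof.
move=> [a a0 pE] [b b0 qE]; exists (fun v => a v + b v).
  by move=> v vS; rewrite addr_ge0 ?a0 ?b0.
by rewrite raddfD /= pE qE -big_split; apply: eq_bigr => v _; rewrite scalerDl.
Qed.

Lemma spanned_coneZ S t p : 0 < t -> spanned_cone S p -> spanned_cone S (t *: p).
Proof.
move=> t0 [a a0 pE]; exists (fun v => t * a v).
  by move=> v vS; rewrite mulr_ge0 ?a0 // ltW.
by rewrite linearZ /= pE scaler_sumr; apply: eq_bigr => v _; rewrite scalerA.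
Qed.

Lemma spanned_cone_lift S v : v \in S -> spanned_cone S (lift v).
Proof.
move=> vS; exists (fun u => (u == v)%:R) => [u _|]; first exact: ler0n.
rewrite liftK (big_fsetD1 v) //= eqxx scale1r big1_seq ?addr0 // => u.
by rewrite !inE => /andP[_ /andP[/negPf -> _]]; rewrite scale0r.
Qed.

Lemma spanned_cone_sub S p : {in S, forall v, cone_at p (lift v)} ->
  (spanned_cone S `<=` cone_at p)%classic.
Proof.
move=> Sp w [a a0 wE].
have : cone_at p (\sum_(v <- S) a v *: lift v).
  rewrite big_seq; apply: big_ind => [|q q'|v vS].
  - exact/flat_cone_at/flat0.
  - exact: cone_atD.
  - by apply/cone_atZ/Sp => //; apply: a0.
apply: (cone_at_proj k_gt0); rewrite wE raddf_sum /=.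
by apply: eq_bigr => v _; rewrite linearZ /= liftK.
Qed.

(** [cone_at_ray_ind] reduces the harder inclusion to flat vectors and ray points; the latter are
    positive multiples of primitive generators modulo lineality. *)
Lemma spanned_cone_rays p : Dr p -> spanned_cone (cone_rays (cone_at p)) = cone_at p.
Proof.
move=> Dp; apply/seteqP; split=> [|w pw].
  by apply: spanned_cone_sub => v /cone_raysP[].
apply: cone_at_ray_ind => [u|u wu ru|u u'|t u].
- exact: spanned_cone_flat.
- have pu := cone_at_trans pw wu; have Du := cone_at_Dr Dp pu.
  have [t t0 tR] := ray_point_primitive k_gt0 Du ru.
  have : t *: proj u \in cone_rays (cone_at p).
    apply/cone_raysP; split=> //.
    apply: (cone_at_proj k_gt0 (q := t *: u)); first by rewrite liftK linearZ.
    exact/cone_atZ/pu/ltW.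
  move/spanned_cone_lift/(spanned_coneZ (t := t^-1)); rewrite invr_gt0 => /(_ t0).
  case=> a a0 aE; exists a => //; rewrite -aE linearZ /= liftK.
  by rewrite scalerK // gt_eqF.
- exact: spanned_coneD.
- exact: spanned_coneZ.
Qed.

Lemma compatible_cone_rays p : Dr p -> compatible_collection (cone_rays (cone_at p)).
Proof.
move=> Dp; split=> [v /cone_raysP[]//|u v /cone_raysP[_ pu] /cone_raysP[_ pv]].
exists (lift u + lift v); last by rewrite raddfD /= !liftK.
exact: cone_at_Dr Dp (cone_atD pu pv).
Qed.

(** The point [p] is the sum of the representatives; its cone contains each of them by
    [pairwise_Dr_sum]. *)
Lemma compatible_sub_cone_rays S : compatible_collection S ->
  exists2 p, Dr p & (S `<=` cone_rays (cone_at p))%fset.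
Proof.
move=> [SR Scomp]; have [||DS SC] := @pairwise_Dr_sum R k n [seq lift v | v <- S].
- move=> _ _ /mapP[u uS ->] /mapP[v vS ->].
  have [p Dp pE] := Scomp u v uS vS.
  by apply: (Dr_proj k_gt0) Dp; rewrite pE raddfD /= !liftK.
- by move=> _ /mapP[v /SR vR ->]; have [] := Dr_rays_lift k_gt0 vR.
- exists (\sum_(p <- [seq lift v | v <- S]) p) => //.
  apply/fsubsetP => v vS; apply/cone_raysP; split; first exact: SR.
  exact/SC/map_f.
Qed.

(** By maximality [S] is the ray set of some cone. The rays of a larger cone form a larger
    compatible collection, so they are [S] again and the cones agree. *)
Lemma maximal_compatible_cone S : maximal_compatible S ->
  maximal_cone (spanned_cone S).
Proof.
move=> [Scomp Smax]; have [p Dp Sp] := compatible_sub_cone_rays Scomp.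
have SE := Smax _ (compatible_cone_rays Dp) Sp.
rewrite -SE spanned_cone_rays //; split; first by exists p.
move=> _ [q Dq <-] pq.
have Sq : (S `<=` cone_rays (cone_at q))%fset.
  by apply/fsubsetP => v; rewrite -SE => /cone_raysP[vR /pq qv]; apply/cone_raysP.
have qS := Smax _ (compatible_cone_rays Dq) Sq.
by rewrite -(spanned_cone_rays Dq) qS -SE spanned_cone_rays.
Qed.

(** A compatible collection containing the rays of [C] lies among the rays of some cone, which
    contains [C] and hence equals it. *)
Lemma maximal_compatible_rays C : maximal_cone C ->
  maximal_compatible (cone_rays C).
Proof.
move=> [[p Dp <-] Cmax]; split=> [|S Scomp pS]; first exact: compatible_cone_rays.
have [q Dq Sq] := compatible_sub_cone_rays Scomp.
have qE : cone_at q = cone_at p.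
  apply: Cmax; first by exists q.
  rewrite -(spanned_cone_rays Dp); apply: spanned_cone_sub => v.
  by move=> /(fsubsetP pS)/(fsubsetP Sq)/cone_raysP[].
by apply/eqP; rewrite eqEfsubset pS andbT -qE.
Qed.

End MaximalCones.

Theorem theorem3p4 (R : realType) (k n : nat) (k_gt0 : (0 < k)%N) (k_le_n : (k <= n)%N) :
  (forall S : {fset vquot (lineality R k n)},
     maximal_compatible S -> maximal_cone (spanned_cone S)) /\
  (forall C : set (plucker_space R k n),
     maximal_cone C ->
     exists! S : {fset vquot (lineality R k n)},
       maximal_compatible S /\ C = spanned_cone S).
Proof.
split=> [S|C Cmax]; first exact: maximal_compatible_cone.
have [[p Dp pC] _] := Cmax; exists (cone_rays C); split.
  split; first exact: maximal_compatible_rays.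
  by rewrite -pC spanned_cone_rays.
move=> S [[[SR Scomp] Smax] CS].
(* [S] lies in its spanned cone [C], hence among the rays of [C]; maximality of [S] gives
   equality. *)
apply: Smax; first by rewrite -pC; apply: compatible_cone_rays.
apply/fsubsetP => v vS; apply/cone_raysP => //; split; first exact: SR.
by rewrite CS; apply: spanned_cone_lift.
Qed.
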